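(* Let $f:(\mathbb{R}^2,0)\to(\mathbb{R}^3,0)$ be a map-germ of the form $$f(u,v)=\Big(u,\ \frac{a_{20}}{2}u^2+\frac{a_{30}}{6}u^3+\frac12 v^2,\ \frac{b_{20}}{2}u^2+\frac{b_{30}}{6}u^3+\frac{b_{12}}{2}uv^2+\frac{b_{03}}{6}v^3\Big)+h(u,v),$$ with $b_{03}\ne0$, $b_{20}\ge0$ and $h(u,v)=(0,\ u^4h_1(u),\ u^4h_2(u)+u^2v^2h_3(u)+uv^3h_4(u)+v^4h_5(u,v))$, where $h_1,\dots,h_5$ are smooth functions. Let $\kappa_s$, $\kappa_n$ and $\kappa_u$ be the singular curvature, the normal curvature and the umbilic curvature of the cuspidal edge, and let $\kappa$ and $\tau$ be the curvature and torsion of the space curve $f|_{S(f)}$, that is, of $\hat\gamma(u)=f(u,0)$; a prime denotes the derivative $d/du$ along the singular set $S(f)=\{v=0\}$. Then at the origin $$\kappa_s=a_{20},\qquad \kappa_s'=a_{30}+b_{12}b_{20},\qquad \kappa_n=\kappa_u=b_{20},\qquad \kappa_n'=b_{30}-a_{20}b_{12},$$ $$\kappa=\sqrt{a_{20}^2+b_{20}^2},\qquad \kappa'=\frac{a_{20}a_{30}+b_{20}b_{30}}{\sqrt{a_{20}^2+b_{20}^2}},\qquad \tau=\frac{a_{20}b_{30}-b_{20}a_{30}}{a_{20}^2+b_{20}^2}.$$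
   Context: All maps are $C^\infty$. For $f$ as in the claim, the origin is a cuspidal edge (the germ becomes $(u,v)\mapsto(u,v^2,v^3)$ after composing with diffeomorphism-germs of source and target), the singular set near $0$ is $S(f)=\{v=0\}$, and $\partial_v$ spans $\ker df$ along $S(f)$. Let $\nu$ be a smooth unit normal vector field along $f$ (i.e. $\nu\perp\operatorname{Im}df$), $\lambda=\det(f_u,f_v,\nu)$, $\gamma(u)=(u,0)$, $\hat\gamma=f\circ\gamma$, $\eta=\partial_v$. The singular curvature and the limiting normal curvature at $\gamma(u)$ are $$\kappa_s(u)=\operatorname{sgn}(d\lambda(\eta))\frac{\det(\hat\gamma'(u),\hat\gamma''(u),\nu(\gamma(u)))}{|\hat\gamma'(u)|^3},\qquad \kappa_\nu(u)=\frac{\langle\hat\gamma''(u),\nu(\gamma(u))\rangle}{|\hat\gamma'(u)|^2},$$ and the (absolute) normal curvature is $\kappa_n=|\kappa_\nu|$. Umbilic curvature at the cuspidal edge $0$: let $M$ be the image of $f$, $T_0M=\operatorname{Im}df_0$ (a line), $N_0M$ its orthogonal complement in $\mathbb{R}^3$, $w\mapsto w^\perp$ the orthogonal projection to $N_0M$. Let $\mathrm{I}(X,Y)=\langle df_0(X),df_0(Y)\rangle$, and let $\mathrm{II}$ be the $N_0M$-valued symmetric bilinear map on $T_0\mathbb{R}^2$ with $\mathrm{II}(\partial_u,\partial_u)=f_{uu}^\perp(0)$, $\mathrm{II}(\partial_u,\partial_v)=f_{uv}^\perp(0)$, $\mathrm{II}(\partial_v,\partial_v)=f_{vv}^\perp(0)$.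 The set $\Delta=\{\mathrm{II}(X,X):\mathrm{I}(X,X)^{1/2}=1\}$ is a half-line in $N_0M$, and for any parametrization $\alpha(s)$ of it, $\kappa_u=|\alpha(s)\times\alpha'(s)|/|\alpha'(s)|$ for any $s$ with $\alpha'(s)\neq0$ (equivalently, the distance from the origin to the line containing $\Delta$).
   Formalization: For b20=0, κ_n=|κ_ν| need not be differentiable at 0, so κ_n' is asserted for b20>0, or whenever the derivative exists, and for κ_ν' when ν(0) has positive third component; κ' and τ are claimed only when a20²+b20²≠0. *)

(* Defs.v *)
From Stdlib Require Import Reals.
From Coquelicot Require Import Coquelicot.
Open Scope R_scope.

(** Euclidean three-space.  Sums, multiples and the zero vector are Coquelicot's
    [plus], [scal] and [zero] on products. *)

Definition V3 : Type := (R * R * R)%type.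

Definition c1 (w : V3) : R := fst (fst w).
Definition c2 (w : V3) : R := snd (fst w).
Definition c3 (w : V3) : R := snd w.

Definition dot (w z : V3) : R := c1 w * c1 z + c2 w * c2 z + c3 w * c3 z.

Definition cross (w z : V3) : V3 :=
  (c2 w * c3 z - c3 w * c2 z,
   c3 w * c1 z - c1 w * c3 z,
   c1 w * c2 z - c2 w * c1 z).

Definition det3 (w z t : V3) : R := dot (cross w z) t.

Definition enorm (w : V3) : R := sqrt (dot w w).

(** Smoothness ([C^oo] on some neighbourhood of the given point) and
    derivatives, taken componentwise for vector-valued maps. *)

Definition smooth1_at (g : R -> R) (t : R) : Prop :=
  locally t (fun s => forall n : nat, ex_derive_n g n s).

Definition smooth2_at (g : R -> R -> R) (u v : R) : Prop :=
  locally_2d (fun x y => forall n : nat, ex_diff_n g n x y) u v.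

Definition smooth_curve_at (g : R -> V3) (t : R) : Prop :=
  smooth1_at (fun s => c1 (g s)) t /\
  smooth1_at (fun s => c2 (g s)) t /\
  smooth1_at (fun s => c3 (g s)) t.

Definition smooth_map_at (g : R -> R -> V3) (u v : R) : Prop :=
  smooth2_at (fun x y => c1 (g x y)) u v /\
  smooth2_at (fun x y => c2 (g x y)) u v /\
  smooth2_at (fun x y => c3 (g x y)) u v.

Definition vderive (g : R -> V3) (t : R) : V3 :=
  (Derive (fun s => c1 (g s)) t,
   Derive (fun s => c2 (g s)) t,
   Derive (fun s => c3 (g s)) t).

Definition Du (f : R -> R -> V3) (u v : R) : V3 := vderive (fun x => f x v) u.
Definition Dv (f : R -> R -> V3) (u v : R) : V3 := vderive (fun y => f u y) v.

(** Curvature and torsion of a regular space curve in an arbitrary parameter;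
    the torsion is meaningful only where the curvature does not vanish. *)

Definition curvature (g : R -> V3) (t : R) : R :=
  enorm (cross (vderive g t) (vderive (vderive g) t)) / enorm (vderive g t) ^ 3.

Definition torsion (g : R -> V3) (t : R) : R :=
  det3 (vderive g t) (vderive (vderive g) t) (vderive (vderive (vderive g)) t)
  / enorm (cross (vderive g t) (vderive (vderive g) t)) ^ 2.

(** Invariants along the singular curve [u |-> (u, 0)], the null direction
    being [d/dv]. *)

Definition unit_normal_near0 (f nu : R -> R -> V3) : Prop :=
  smooth_map_at nu 0 0 /\
  locally_2d (fun u v => dot (nu u v) (nu u v) = 1 /\
                         dot (nu u v) (Du f u v) = 0 /\
                         dot (nu u v) (Dv f u v) = 0) 0 0.

Definition singular_image (f : R -> R -> V3) (u : R) : V3 := f u 0.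

Definition lambda (f nu : R -> R -> V3) (u v : R) : R :=
  det3 (Du f u v) (Dv f u v) (nu u v).

Definition kappa_s (f nu : R -> R -> V3) (u : R) : R :=
  let g := singular_image f in
  sign (Derive (fun v => lambda f nu u v) 0)
  * (det3 (vderive g u) (vderive (vderive g) u) (nu u 0)
     / enorm (vderive g u) ^ 3).

Definition kappa_nu (f nu : R -> R -> V3) (u : R) : R :=
  let g := singular_image f in
  dot (vderive (vderive g) u) (nu u 0) / enorm (vderive g u) ^ 2.

Definition kappa_n (f nu : R -> R -> V3) (u : R) : R := Rabs (kappa_nu f nu u).

(** Umbilic curvature at the origin; tangent vectors of the source are pairs
    of coordinates in the basis [d/du], [d/dv]. *)

Definition df0 (f : R -> R -> V3) (X : R * R) : V3 :=
  plus (scal (fst X) (Du f 0 0)) (scal (snd X) (Dv f 0 0)).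

Definition fundI (f : R -> R -> V3) (X Y : R * R) : R :=
  dot (df0 f X) (df0 f Y).

(** [p] is the orthogonal projection of [w] to the orthogonal complement of
    the image of [df0 f]. *)
Definition is_perp (f : R -> R -> V3) (w p : V3) : Prop :=
  (forall X : R * R, dot p (df0 f X) = 0) /\
  (exists X : R * R, w = plus p (df0 f X)).

(** [q = II(X, Y)]; stated as a relation because [is_perp] is one. *)
Definition is_fundII (f : R -> R -> V3) (X Y : R * R) (q : V3) : Prop :=
  exists puu puv pvv : V3,
    is_perp f (Du (Du f) 0 0) puu /\
    is_perp f (Dv (Du f) 0 0) puv /\
    is_perp f (Dv (Dv f) 0 0) pvv /\
    q = plus (scal (fst X * fst Y) puu)
          (plus (scal (fst X * snd Y + snd X * fst Y) puv)
                (scal (snd X * snd Y) pvv)).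

Definition Delta (f : R -> R -> V3) (q : V3) : Prop :=
  exists X : R * R, sqrt (fundI f X X) = 1 /\ is_fundII f X X q.

(** [alpha], restricted to the nondegenerate interval [D], is a smooth
    parametrization of the set [E]. *)
Definition parametrizes (D : R -> Prop) (alpha : R -> V3) (E : V3 -> Prop) : Prop :=
  (exists s t : R, D s /\ D t /\ s < t) /\
  (forall r s t : R, D r -> D t -> r <= s <= t -> D s) /\
  (forall s : R, D s -> smooth_curve_at alpha s) /\
  (forall q : V3, E q <-> exists s : R, D s /\ alpha s = q).

(** [k] is the common value of [|alpha x alpha'| / |alpha'|] over all
    parametrizations of [Delta f] and all their regular points; the first
    clause ensures that there is at least one such point. *)
Definition is_umbilic_curvature (f : R -> R -> V3) (k : R) : Prop :=
  (exists (D : R -> Prop) (alpha : R -> V3) (s : R),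
     parametrizes D alpha (Delta f) /\ D s /\ vderive alpha s <> zero) /\
  (forall (D : R -> Prop) (alpha : R -> V3) (s : R),
     parametrizes D alpha (Delta f) -> D s -> vderive alpha s <> zero ->
     k = enorm (cross (alpha s) (vderive alpha s)) / enorm (vderive alpha s)).

(* Main.v *)
(** Write [f(u, 0) = (u, A, B)].  Since [f_v = v (0, 1, m + O(v))] with
    [m = b12 u + O(u^2)], along the edge the unit normal is orthogonal both to
    [f_u = (1, p, q)], where [p = A'] and [q = B'], and to [(0, 1, m)].  Hence it
    equals [e (p m - q, - m, 1) / N] with [N^2 = 1 + m^2 + (p m - q)^2] and a
    locally constant sign [e], which is also the sign of [d lambda (eta)].
    All curvatures become explicit functions of [p], [q], [p'], [q'] and [m], and
    [p], [q], [m] vanish at the origin.  The set [Delta] is the half-line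
    [{(0, a20 + t, b20) | t >= 0}], at distance [b20] from the origin. *)

From Stdlib Require Import Reals Lra.
From Coquelicot Require Import Coquelicot.
Require Import Defs.
Open Scope R_scope.

(** * Componentwise calculus and one-variable limits at 0 *)

Lemma V3_ext (w z : V3) : c1 w = c1 z -> c2 w = c2 z -> c3 w = c3 z -> w = z.
Proof.
destruct w as [[x y] t], z as [[x' y'] t']; unfold c1, c2, c3; simpl.
now intros -> -> ->.
Qed.

Lemma vderive_eq (g : R -> V3) (t x y z : R) :
  is_derive (fun s => c1 (g s)) t x -> is_derive (fun s => c2 (g s)) t y ->
  is_derive (fun s => c3 (g s)) t z -> vderive g t = (x, y, z).
Proof.
intros H1 H2 H3; unfold vderive.
apply f_equal2; [apply f_equal2|]; now apply is_derive_unique.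
Qed.

Lemma vderive_ext_loc (g k : R -> V3) (t : R) :
  locally t (fun s => g s = k s) -> vderive g t = vderive k t.
Proof.
intros H; unfold vderive.
rewrite (Derive_ext_loc (fun s => c1 (g s)) (fun s => c1 (k s))),
  (Derive_ext_loc (fun s => c2 (g s)) (fun s => c2 (k s))),
  (Derive_ext_loc (fun s => c3 (g s)) (fun s => c3 (k s))); [reflexivity| | |];
  revert H; apply filter_imp; now intros s ->.
Qed.

Lemma sign_mult_pos (x y : R) : 0 < y -> sign (x * y) = sign x.
Proof.
intros Hy; rewrite sign_mult, (sign_eq_1 y Hy); ring.
Qed.

(** The difference quotient at 0 is [psi] itself, so continuity suffices. It is applied to factors
    that already contain first derivatives of [h5]. *)
Lemma is_derive_id_mult (psi : R -> R) :
  continuous psi 0 -> is_derive (fun v => v * psi v) 0 (psi 0).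
Proof.
intros Hc; apply is_derive_Reals; intros e He.
apply continuity_pt_filterlim in Hc.
destruct (Hc e He) as [d [Hd H]].
exists (mkposreal d Hd); simpl; intros h Hh Hhd.
replace (((0 + h) * psi (0 + h) - 0 * psi 0) / h - psi 0)
  with (psi h - psi 0) by (rewrite Rplus_0_l; field; assumption).
apply (H h); split.
- split; [exact I | auto].
- simpl; unfold Rdist; now rewrite Rminus_0_r.
Qed.

(** Serves to divide an identity by [v]: the quotient identity is known only off 0 and extends to 0
    by continuity. *)
Lemma continuous_zero_at_0 (phi : R -> R) :
  continuous phi 0 -> locally 0 (fun v => v <> 0 -> phi v = 0) -> phi 0 = 0.
Proof.
intros Hc [d Hd].
destruct (Req_dec (phi 0) 0) as [|Hn]; [assumption|exfalso].
apply continuity_pt_filterlim in Hc.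
destruct (Hc (Rabs (phi 0)) (Rabs_pos_lt _ Hn)) as [r [Hr H]].
pose proof (cond_pos d) as Hd0.
assert (Hm : 0 < Rmin d r) by (apply Rmin_pos; assumption).
pose proof (Rmin_l d r); pose proof (Rmin_r d r).
set (h := Rmin d r / 2) in *.
assert (Hh : 0 < h /\ h < d /\ h < r) by (unfold h; lra).
assert (Hz : phi h = 0).
{ apply Hd; [|lra]. change (Rabs (h - 0) < d).
  rewrite Rminus_0_r, Rabs_pos_eq; lra. }
specialize (H h); simpl in H; unfold Rdist in H.
rewrite Hz, Rminus_0_r, Rminus_0_l, Rabs_Ropp, (Rabs_pos_eq h) in H by lra.
assert (Rabs (phi 0) < Rabs (phi 0)); [|lra].
apply H; split; [split; [exact I | lra] | lra].
Qed.

Lemma continuous_slice_y (g : R -> R -> R) (u v : R) :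
  continuity_2d_pt g u v -> continuous (fun y => g u y) v.
Proof.
intros H; apply continuity_pt_filterlim, continuity_pt_locally; intros e.
destruct (H e) as [d Hd]; exists d; intros y Hy.
apply Hd; [rewrite Rminus_diag, Rabs_R0; apply cond_pos | exact Hy].
Qed.

Lemma continuous_slice_x (g : R -> R -> R) (u v : R) :
  continuity_2d_pt g u v -> continuous (fun x => g x v) u.
Proof.
intros H; apply continuity_pt_filterlim, continuity_pt_locally; intros e.
destruct (H e) as [d Hd]; exists d; intros y Hy.
apply Hd; [exact Hy | rewrite Rminus_diag, Rabs_R0; apply cond_pos].
Qed.

(** * The unit normal on a line transversal to the edge *)

Definition vcontinuous (g : R -> V3) (t : R) : Prop :=
  continuous (fun s => c1 (g s)) t /\ continuous (fun s => c2 (g s)) t /\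
  continuous (fun s => c3 (g s)) t.

(* [n], [X] and [(0, v, v * M v)] are [nu], [f_u] and [f_v] on a line [u = const].
   Dividing [<n, f_v> = 0] by [v] and letting [v -> 0] shows that [n 0] is also
   orthogonal to [(0, 1, M 0)], which determines it up to sign. *)
Lemma normal_at (n X : R -> V3) (M : R -> R) (p q : R) :
  vcontinuous n 0 -> vcontinuous X 0 -> continuous M 0 ->
  X 0 = (1, p, q) ->
  locally 0 (fun v => dot (n v) (n v) = 1 /\ dot (n v) (X v) = 0 /\
                      dot (n v) (0, v, v * M v) = 0) ->
  let w := c3 (n 0) in
  let m := M 0 in
  let N2 := 1 + m ^ 2 + (p * m - q) ^ 2 in
  n 0 = (w * (p * m - q), - w * m, w) /\ w ^ 2 * N2 = 1 /\
  is_derive (fun v => det3 (X v) (0, v, v * M v) (n v)) 0 (w * N2).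
Proof.
intros [Hn1 [Hn2 Hn3]] [HX1 [HX2 HX3]] HM HX0 HL w m N2.
destruct (locally_singleton _ _ HL) as [E1 [E2 _]].
assert (E3 : c2 (n 0) + c3 (n 0) * M 0 = 0).
{ apply (continuous_zero_at_0 (fun v => c2 (n v) + c3 (n v) * M v)).
  - apply @continuous_plus; [exact Hn2|]; now apply @continuous_mult.
  - revert HL; apply filter_imp; intros v [_ [_ H]] Hv.
    unfold dot in H; cbn in H.
    apply (Rmult_eq_reg_l v); [|assumption].
    rewrite Rmult_0_r, <- H; unfold c1, c2, c3; cbn; ring. }
rewrite HX0 in E2.
change (c1 (n 0) * 1 + c2 (n 0) * p + c3 (n 0) * q = 0) in E2.
unfold dot in E1.
fold w m in E3.
assert (F2 : c2 (n 0) = - w * m) by lra.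
assert (F1 : c1 (n 0) = w * (p * m - q)).
{ fold w in E2; rewrite F2 in E2; lra. }
split; [|split].
- apply V3_ext; [exact F1 | exact F2 | reflexivity].
- fold w in E1; rewrite F1, F2 in E1; rewrite <- E1; unfold N2; ring.
(* The second argument [(0, v, v * M v)] gives the determinant a factor [v]; its derivative at 0 is
   the value of the cofactor there. *)
- apply (is_derive_ext (fun v => v *
    ((c2 (X v) * M v - c3 (X v)) * c1 (n v) - c1 (X v) * M v * c2 (n v)
      + c1 (X v) * c3 (n v)))).
  { intros v; unfold det3, dot, cross; unfold c1, c2, c3; cbn; ring. }
  replace (w * N2) with
    ((c2 (X 0) * M 0 - c3 (X 0)) * c1 (n 0) - c1 (X 0) * M 0 * c2 (n 0)
      + c1 (X 0) * c3 (n 0)).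
  2:{ rewrite HX0, F1, F2; unfold N2; fold w m; unfold c1, c2, c3; cbn; ring. }
  apply (is_derive_id_mult (fun v =>
     (c2 (X v) * M v - c3 (X v)) * c1 (n v) - c1 (X v) * M v * c2 (n v)
      + c1 (X v) * c3 (n v))).
  repeat first [ assumption | apply @continuous_plus | apply @continuous_minus
    | apply @continuous_mult | apply @continuous_opp ].
Qed.

(** * The singular curve as a graph, and derivatives of the curvature formulas *)

(** The second and third coordinates of the singular curve have this form. [jet'] and [jet''] are
    its first two derivatives in closed form, grouped so that their values at 0 are evident. *)
Definition jet (a b : R) (h : R -> R) (u : R) : R :=
  a / 2 * u ^ 2 + b / 6 * u ^ 3 + u ^ 4 * h u.

Definition jet' (a b : R) (h : R -> R) (u : R) : R :=
  a * u + b / 2 * u ^ 2 + u ^ 3 * (4 * h u + u * Derive h u).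

Definition jet'' (a b : R) (h : R -> R) (u : R) : R :=
  a + b * u
  + u ^ 2 * (12 * h u + 8 * u * Derive h u + u ^ 2 * Derive (Derive h) u).

Lemma is_derive_jet (a b : R) (h : R -> R) (u : R) :
  ex_derive h u -> is_derive (jet a b h) u (jet' a b h u).
Proof.
intros H; unfold jet, jet'; auto_derive; [assumption |].
change (fun x => h x) with h; field.
Qed.

Lemma is_derive_jet' (a b : R) (h : R -> R) (u : R) :
  ex_derive h u -> ex_derive (Derive h) u ->
  is_derive (jet' a b h) u (jet'' a b h u).
Proof.
intros H H'; unfold jet', jet''; auto_derive.
- repeat split; assumption.
- change (fun x => h x) with h.
  change (fun x => Derive h x) with (Derive h); field.
Qed.

Lemma is_derive_jet''_0 (a b : R) (h : R -> R) :
  ex_derive h 0 -> ex_derive (Derive h) 0 -> ex_derive (Derive (Derive h)) 0 ->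
  is_derive (jet'' a b h) 0 b.
Proof.
intros H H' H''; unfold jet''; auto_derive.
- repeat split; assumption.
- ring.
Qed.

(** Replaces the derivatives left by [auto_derive], which are eta-expanded, by their known values;
    clearing [H] makes the loop stop. *)
Ltac derive_at_0 :=
  repeat match goal with
  | H : is_derive ?k 0 ?l |- _ =>
      let E := fresh in
      assert (E : Derive (fun x : R => k x) 0 = l)
        by exact (is_derive_unique k 0 l H);
      rewrite ?E; clear H E
  end.

Ltac values_at_0 :=
  repeat match goal with H : ?k 0 = _ |- context [?k 0] => rewrite H end.

Ltac sqrt_one :=
  repeat match goal with
  | |- context [sqrt ?x] =>
      lazymatch x with 1 => fail | _ => replace x with 1 by ring end
  end;
  rewrite ?sqrt_1.

(** Since [p], [q], [m] vanish at 0, both radicands are 1 and stationary there, and the last product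
    in the numerator vanishes to second order. Only the derivative of [p' + m * q'] remains. That
    [p'] is the derivative of [p] is used only at 0, through the common value [a]; likewise [q'] and
    [b]. *)
Lemma is_derive_singular_curvature (p q p' q' m : R -> R) (a a' b b' c : R) :
  p 0 = 0 -> q 0 = 0 -> m 0 = 0 -> p' 0 = a -> q' 0 = b ->
  is_derive p 0 a -> is_derive q 0 b -> is_derive m 0 c ->
  is_derive p' 0 a' -> is_derive q' 0 b' ->
  is_derive (fun u =>
    (p' u + m u * q' u + (p u * m u - q u) * (p u * q' u - q u * p' u))
    / sqrt (1 + m u ^ 2 + (p u * m u - q u) ^ 2)
    / sqrt (1 + p u ^ 2 + q u ^ 2) ^ 3) 0 (a' + c * b).
Proof.
intros P0 Q0 M0 P'0 Q'0 HP HQ HM HP' HQ'; auto_derive.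
- values_at_0; sqrt_one.
  repeat split; try (eexists; eassumption); lra.
- derive_at_0; values_at_0; sqrt_one; field.
Qed.

(** The denominators are again stationary at 0, which leaves the derivative of [q' - m * p']. The
    sign of the normal is left out of the formula. *)
Lemma is_derive_normal_curvature (p q p' q' m : R -> R) (a a' b b' c : R) :
  p 0 = 0 -> q 0 = 0 -> m 0 = 0 -> p' 0 = a -> q' 0 = b ->
  is_derive p 0 a -> is_derive q 0 b -> is_derive m 0 c ->
  is_derive p' 0 a' -> is_derive q' 0 b' ->
  is_derive (fun u =>
    (q' u - m u * p' u) / sqrt (1 + m u ^ 2 + (p u * m u - q u) ^ 2)
    / sqrt (1 + p u ^ 2 + q u ^ 2) ^ 2) 0 (b' - a * c).
Proof.
intros P0 Q0 M0 P'0 Q'0 HP HQ HM HP' HQ'; auto_derive.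
- values_at_0; sqrt_one.
  repeat split; try (eexists; eassumption); lra.
- derive_at_0; values_at_0; sqrt_one; field.
Qed.

(** The first square vanishes to second order at 0 and the speed is stationary, so the derivative is
    that of the square root of [q' ^ 2 + p' ^ 2], whose radicand is nonzero at 0 by hypothesis. *)
Lemma is_derive_graph_curvature (p q p' q' : R -> R) (a a' b b' : R) :
  a ^ 2 + b ^ 2 <> 0 ->
  p 0 = 0 -> q 0 = 0 -> p' 0 = a -> q' 0 = b ->
  is_derive p 0 a -> is_derive q 0 b ->
  is_derive p' 0 a' -> is_derive q' 0 b' ->
  is_derive (fun u =>
    sqrt ((p u * q' u - q u * p' u) ^ 2 + q' u ^ 2 + p' u ^ 2)
    / sqrt (1 + p u ^ 2 + q u ^ 2) ^ 3) 0
    ((a * a' + b * b') / sqrt (a ^ 2 + b ^ 2)).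
Proof.
intros Hab P0 Q0 P'0 Q'0 HP HQ HP' HQ'.
assert (Hpos : 0 < a ^ 2 + b ^ 2).
{ pose proof (pow2_ge_0 a); pose proof (pow2_ge_0 b); lra. }
assert (Hs : sqrt (a ^ 2 + b ^ 2) <> 0) by (apply Rgt_not_eq, sqrt_lt_R0, Hpos).
auto_derive.
- values_at_0.
  replace (1 + _ + _) with 1 by ring; rewrite sqrt_1.
  repeat split; try (eexists; eassumption); try lra; nra.
- derive_at_0; values_at_0.
  repeat match goal with |- context [sqrt (1 + ?x + ?y)] =>
    replace (1 + x + y) with 1 by ring end.
  repeat match goal with |- context [sqrt (?x + b * ?y + ?z)] =>
    replace (x + b * y + z) with (a ^ 2 + b ^ 2) by ring end.
  rewrite sqrt_1; field; exact Hs.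
Qed.

(** * The derivative of an absolute value *)

Lemma is_derive_Rabs_pos (K : R -> R) (L : R) :
  0 < K 0 -> is_derive K 0 L -> is_derive (fun u => Rabs (K u)) 0 L.
Proof.
intros H0 HK; apply (is_derive_ext_loc K); [|exact HK].
assert (Hc : continuous K 0) by (apply (ex_derive_continuous K); now exists L).
assert (Hl : locally 0 (fun u => 0 < K u)) by exact (Hc _ (open_gt 0 (K 0) H0)).
revert Hl; apply filter_imp.
intros u Hu; symmetry; apply Rabs_pos_eq; now apply Rlt_le.
Qed.

(* At a zero of [K] the derivative of [|K|] can only be [0], and then [K' = 0]. *)
Lemma is_derive_Rabs_zero (K : R -> R) (L l : R) :
  K 0 = 0 -> is_derive K 0 L -> is_derive (fun u => Rabs (K u)) 0 l -> l = L.
Proof.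
intros H0 HK HA; apply is_derive_Reals in HK; apply is_derive_Reals in HA.
(* The difference quotients of [Rabs K] at [h] and [- h] have opposite signs and are both within [e]
   of [l], so [Rabs l <= e]. Then [Rabs (K h) / h] is at most [2 * e], and the quotient of [K] is
   within [e] of [L]. *)
assert (B : forall e, 0 < e -> Rabs l <= e /\ Rabs L <= 3 * e).
{ intros e He.
  destruct (HK e He) as [d1 Hd1], (HA e He) as [d2 Hd2].
  pose proof (cond_pos d1); pose proof (cond_pos d2).
  pose proof (Rmin_l d1 d2); pose proof (Rmin_r d1 d2).
  assert (0 < Rmin d1 d2) by now apply Rmin_pos.
  set (h := Rmin d1 d2 / 2) in *.
  assert (Hh : 0 < h /\ h < d1 /\ h < d2) by (unfold h; lra).
  assert (Hi : 0 < / h) by (apply Rinv_0_lt_compat; lra).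
  assert (A1 := Hd2 h); assert (A2 := Hd2 (- h)); assert (A3 := Hd1 h).
  rewrite Rabs_Ropp in A2; rewrite !(Rabs_pos_eq h) in * by lra.
  rewrite Rplus_0_l, H0, ?Rabs_R0, !Rminus_0_r in *.
  specialize (A1 ltac:(lra) ltac:(lra)); specialize (A2 ltac:(lra) ltac:(lra)).
  specialize (A3 ltac:(lra) ltac:(lra)).
  replace (Rabs (K (- h)) / - h) with (- (Rabs (K (- h)) * / h)) in A2
    by (field; lra).
  unfold Rdiv in A1, A3.
  pose proof (Rmult_le_pos _ _ (Rabs_pos (K (- h))) (Rlt_le _ _ Hi)).
  pose proof (Rmult_le_pos _ _ (Rabs_pos (K h)) (Rlt_le _ _ Hi)).
  assert (E : Rabs (K h * / h) = Rabs (K h) * / h)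
    by (rewrite Rabs_mult, (Rabs_pos_eq (/ h)); lra).
  apply Rabs_def2 in A1, A2, A3; destruct A1, A2, A3.
  split; [apply Rabs_le; lra|].
  pose proof (Rle_abs (K h * / h)); pose proof (Rle_abs (- (K h * / h))) as HN.
  rewrite Rabs_Ropp in HN; apply Rabs_le; lra. }
assert (Z : forall x, (forall e, 0 < e -> Rabs x <= 3 * e) -> x = 0).
{ intros x Hx; destruct (Req_dec x 0) as [|Hn]; [assumption|].
  pose proof (Rabs_pos_lt _ Hn); specialize (Hx (Rabs x / 4)); lra. }
rewrite (Z l), (Z L); [reflexivity| |]; intros e He; destruct (B e He); lra.
Qed.

(** * The half-line [Delta] and the umbilic curvature *)

(** The point [s] may be an endpoint of [D], with [g] uncontrolled on the other side. As the
    derivative exists, increments that stay in [D] determine it. *)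
Lemma Derive_constant_on_interval (D : R -> Prop) (g : R -> R) (s k : R) :
  (exists r t : R, D r /\ D t /\ r < t) ->
  (forall r x t : R, D r -> D t -> r <= x <= t -> D x) ->
  (forall x, D x -> g x = k) -> D s -> ex_derive g s -> Derive g s = 0.
Proof.
intros [r [t [Hr [Ht Hrt]]]] Hconv Hk Hs [l Hl].
rewrite (is_derive_unique _ _ _ Hl).
apply is_derive_Reals in Hl.
assert (Hside : exists x, D x /\ x <> s).
{ destruct (Req_dec r s) as [->|]; [exists t | exists r]; split; auto; lra. }
destruct Hside as [x [Hx Hxs]].
destruct (Req_dec l 0) as [|Hn]; [assumption|exfalso].
destruct (Hl (Rabs l) (Rabs_pos_lt _ Hn)) as [d Hd].
pose proof (cond_pos d).
assert (HA : 0 < Rabs (x - s)) by (apply Rabs_pos_lt; lra).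
(* The bound [1 / 2] keeps [s + th * (x - s)] between [s] and [x], hence in [D]; the other bound
   makes the increment shorter than [d]. *)
set (th := Rmin (1 / 2) (d / 2 / Rabs (x - s))).
assert (Hth : 0 < th).
{ apply Rmin_pos; [lra|]; apply Rdiv_lt_0_compat; lra. }
assert (Hth1 : th <= 1 / 2) by apply Rmin_l.
assert (Hth2 : th * Rabs (x - s) <= d / 2).
{ apply (Rle_trans _ (d / 2 / Rabs (x - s) * Rabs (x - s))).
  - apply Rmult_le_compat_r; [lra | apply Rmin_r].
  - right; field; lra. }
assert (Hh : th * (x - s) <> 0) by (apply Rmult_integral_contrapositive; lra).
specialize (Hd (th * (x - s)) Hh).
rewrite Rabs_mult, (Rabs_pos_eq th) in Hd by lra.
specialize (Hd ltac:(lra)).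
rewrite (Hk s Hs), (Hk (s + th * (x - s))) in Hd.
- replace ((k - k) / (th * (x - s)) - l) with (- l) in Hd by (field; lra).
  rewrite Rabs_Ropp in Hd; lra.
- destruct (Rle_dec s x).
  + apply (Hconv s _ x); auto; nra.
  + apply (Hconv x _ s); auto; nra.
Qed.

Lemma is_perp_line (f : R -> R -> V3) (w p : V3) :
  Du f 0 0 = (1, 0, 0) -> Dv f 0 0 = (0, 0, 0) ->
  is_perp f w p <-> p = (0, c2 w, c3 w).
Proof.
intros HU HV; unfold is_perp, df0; rewrite HU, HV; split.
- intros [H1 [X ->]].
  specialize (H1 (1, 0)); unfold dot in H1.
  apply V3_ext; unfold c1, c2, c3 in *; cbn in *; lra.
- intros ->; split.
  + intros X; unfold dot, c1, c2, c3; cbn; ring.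
  + exists (c1 w, 0); apply V3_ext; unfold c1, c2, c3; cbn; ring.
Qed.

(** A unit vector has [fst X ^ 2 = 1] and [snd X] free, so [II(X, X)] is [(0, a, b)] plus
    [snd X ^ 2] times [(0, 1, 0)]; the parameter [t] is [snd X ^ 2]. *)
Lemma Delta_half_line (f : R -> R -> V3) (a b : R) :
  Du f 0 0 = (1, 0, 0) -> Dv f 0 0 = (0, 0, 0) ->
  Du (Du f) 0 0 = (0, a, b) -> Dv (Du f) 0 0 = (0, 0, 0) ->
  Dv (Dv f) 0 0 = (0, 1, 0) ->
  forall q, Delta f q <-> exists t, 0 <= t /\ q = (0, a + t, b).
Proof.
intros HU HV HUU HUV HVV q; unfold Delta, is_fundII.
assert (HI : forall X, fundI f X X = fst X ^ 2).
{ intros X; unfold fundI, df0; rewrite HU, HV; unfold dot, c1, c2, c3; cbn; ring. }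
split.
- intros [X [HX [puu [puv [pvv [H1 [H2 [H3 ->]]]]]]]].
  apply is_perp_line in H1, H2, H3; try assumption; subst.
  rewrite HUU, HUV, HVV.
  rewrite HI in HX.
  assert (HX2 : fst X ^ 2 = 1).
  { rewrite <- (sqrt_sqrt (fst X ^ 2)) by apply pow2_ge_0; rewrite HX; ring. }
  exists (snd X ^ 2); split; [apply pow2_ge_0|].
  apply V3_ext; unfold c1, c2, c3; cbn; [ring| |].
  + transitivity (fst X ^ 2 * a + snd X ^ 2); [ring | rewrite HX2; ring].
  + transitivity (fst X ^ 2 * b); [ring | rewrite HX2; ring].
- intros [t [Ht ->]]; exists (1, sqrt t); split.
  + rewrite HI; cbn; replace (1 * (1 * 1)) with 1 by ring; apply sqrt_1.
  + exists (0, a, b), (0, 0, 0), (0, 1, 0).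
    rewrite !is_perp_line by assumption.
    rewrite HUU, HUV, HVV.
    repeat split.
    pose proof (sqrt_sqrt t Ht).
    apply V3_ext; unfold c1, c2, c3; cbn; nra.
Qed.

Lemma enorm_sqr (w : V3) (x : R) : 0 <= x -> dot w w = x ^ 2 -> enorm w = x.
Proof. intros Hx H; unfold enorm; rewrite H; now apply sqrt_pow2. Qed.

Lemma smooth1_at_ex_derive (g : R -> R) (t : R) : smooth1_at g t -> ex_derive g t.
Proof. intros H; exact (locally_singleton _ _ H 1%nat). Qed.

Lemma smooth1_at_const (k t : R) : smooth1_at (fun _ => k) t.
Proof. unfold smooth1_at; apply filter_forall; intros s n; apply ex_derive_n_const. Qed.

(** Along any parametrization the first and third coordinates are constant, so the velocity is
    [(0, y, 0)] and its cross product with the position has norm [b * Rabs y], using [0 <= b]. *)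
Lemma is_umbilic_curvature_half_line (f : R -> R -> V3) (a b : R) :
  0 <= b ->
  (forall q, Delta f q <-> exists t, 0 <= t /\ q = (0, a + t, b)) ->
  is_umbilic_curvature f b.
Proof.
intros Hb HD; split.
(* The affine parametrization is defined on all of [R], so it is smooth and regular at the endpoint
   0 too. *)
- exists (fun s => 0 <= s), (fun s => (0, a + s, b)), 0.
  assert (HV : vderive (fun s => (0, a + s, b) : V3) 0 = (0, 1, 0)).
  { apply vderive_eq; unfold c1, c2, c3; cbn; auto_derive; auto; ring. }
  split; [|split].
  + repeat split.
    * exists 0, 1; lra.
    * intros; lra.
    * exact (smooth1_at_const 0 s).
    * unfold smooth1_at; apply filter_forall; intros s0 n; unfold c2; cbn.
      apply (ex_derive_n_plus (fun _ => a) (fun x => x));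
        apply filter_forall; intros x k Hk.
      -- apply ex_derive_n_const.
      -- apply (ex_derive_n_ext (fun y => y ^ 1)); [intros; ring|].
         apply ex_derive_n_pow.
    * exact (smooth1_at_const b s).
    * intros H; apply HD in H; destruct H as [t [Ht ->]]; now exists t.
    * intros [s [Hs <-]]; apply HD; now exists s.
  + lra.
  + rewrite HV; intros H; apply (f_equal c2) in H.
    unfold c2 in H; cbn in H; lra.
- intros D alpha s [Hne [Hconv [Hsm HE]]] Hs Hreg.
  assert (Hal : forall x, D x -> c1 (alpha x) = 0 /\ c3 (alpha x) = b).
  { intros x Hx; destruct (proj1 (HD (alpha x))) as [t [_ ->]].
    - apply HE; now exists x.
    - split; reflexivity. }
  destruct (Hsm s Hs) as [S1 [S2 S3]].
  assert (W1 : c1 (vderive alpha s) = 0).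
  { apply (Derive_constant_on_interval D (fun x => c1 (alpha x)) s 0); auto.
    - intros x Hx; apply Hal, Hx.
    - now apply smooth1_at_ex_derive. }
  assert (W3 : c3 (vderive alpha s) = 0).
  { apply (Derive_constant_on_interval D (fun x => c3 (alpha x)) s b); auto.
    - intros x Hx; apply Hal, Hx.
    - now apply smooth1_at_ex_derive. }
  destruct (Hal s Hs) as [A1 A3].
  set (w := vderive alpha s) in *.
  assert (W2 : c2 w <> 0).
  { intros H; apply Hreg, V3_ext; assumption. }
  pose proof (Rabs_pos (c2 w)).
  rewrite (enorm_sqr w (Rabs (c2 w))), (enorm_sqr _ (b * Rabs (c2 w))).
  + field; now apply Rabs_no_R0.
  + now apply Rmult_le_pos.
  + rewrite Rpow_mult_distr, pow2_abs; unfold dot.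
    change (c1 (cross (alpha s) w))
      with (c2 (alpha s) * c3 w - c3 (alpha s) * c2 w).
    change (c2 (cross (alpha s) w))
      with (c3 (alpha s) * c1 w - c1 (alpha s) * c3 w).
    change (c3 (cross (alpha s) w))
      with (c1 (alpha s) * c2 w - c2 (alpha s) * c1 w).
    rewrite A1, A3, W1, W3; ring.
  + assumption.
  + unfold dot; rewrite W1, W3, pow2_abs; ring.
Qed.

(** * The normal form and its first partial derivatives *)

Definition edge_form (a20 a30 b20 b30 b12 b03 : R) (h1 h2 h3 h4 : R -> R)
  (h5 : R -> R -> R) (u v : R) : V3 :=
  plus
    ((u,
      a20 / 2 * u ^ 2 + a30 / 6 * u ^ 3 + 1 / 2 * v ^ 2,
      b20 / 2 * u ^ 2 + b30 / 6 * u ^ 3 + b12 / 2 * u * v ^ 2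
        + b03 / 6 * v ^ 3) : V3)
    ((0,
      u ^ 4 * h1 u,
      u ^ 4 * h2 u + u ^ 2 * v ^ 2 * h3 u + u * v ^ 3 * h4 u
        + v ^ 4 * h5 u v) : V3).

(** The third component of [f_v] after division by [v]; on the edge it is the [m] that determines
    the normal. *)
Definition edge_slope (b12 b03 : R) (h3 h4 : R -> R) (h5 : R -> R -> R)
  (u v : R) : R :=
  b12 * u + b03 / 2 * v + 2 * u ^ 2 * h3 u + 3 * u * v * h4 u
  + 4 * v ^ 2 * h5 u v + v ^ 3 * Derive (fun y => h5 u y) v.

(** The part of the third component of [f_u] that depends on [v], divided by [v]. It still vanishes
    on the edge, whence [f_uv = 0] at the origin. *)
Definition edge_twist (b12 : R) (h3 h4 : R -> R) (h5 : R -> R -> R)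
  (u v : R) : R :=
  b12 / 2 * v + (2 * u * h3 u + u ^ 2 * Derive h3 u) * v
  + (h4 u + u * Derive h4 u) * v ^ 2 + v ^ 3 * Derive (fun x => h5 x v) u.

Lemma Dv_edge_form (a20 a30 b20 b30 b12 b03 : R) (h1 h2 h3 h4 : R -> R)
  (h5 : R -> R -> R) (u v : R) :
  ex_derive (fun y => h5 u y) v ->
  Dv (edge_form a20 a30 b20 b30 b12 b03 h1 h2 h3 h4 h5) u v
  = (0, v, v * edge_slope b12 b03 h3 h4 h5 u v).
Proof.
intros H; unfold edge_slope; apply vderive_eq; unfold c1, c2, c3; cbn -[pow].
- auto_derive; auto.
- auto_derive; [auto | field].
- auto_derive; [auto | field].
Qed.

Lemma Du_edge_form (a20 a30 b20 b30 b12 b03 : R) (h1 h2 h3 h4 : R -> R)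
  (h5 : R -> R -> R) (u v : R) :
  ex_derive h1 u -> ex_derive h2 u -> ex_derive h3 u -> ex_derive h4 u ->
  ex_derive (fun x => h5 x v) u ->
  Du (edge_form a20 a30 b20 b30 b12 b03 h1 h2 h3 h4 h5) u v
  = (1, jet' a20 a30 h1 u,
     jet' b20 b30 h2 u + v * edge_twist b12 h3 h4 h5 u v).
Proof.
intros E1 E2 E3 E4 E5; unfold edge_twist, jet'.
apply vderive_eq; unfold c1, c2, c3; cbn -[pow].
- auto_derive; [auto | ring].
- auto_derive; [auto | change (fun x => h1 x) with h1; field].
- auto_derive; [now repeat split|].
  change (fun x => h2 x) with h2; change (fun x => h3 x) with h3.
  change (fun x => h4 x) with h4; field.
Qed.

(** * The unit normal along the edge and its sign *)

Lemma locally_2d_of_1d (P : R -> Prop) (x y : R) :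
  locally x P -> locally_2d (fun u _ => P u) x y.
Proof. intros [d Hd]; exists d; intros u v Hu _; now apply Hd. Qed.

(** The product of [w] and [sqrt N2] has square 1 and the sign of [w]. *)
Lemma sign_over_sqrt (w N2 : R) :
  0 < N2 -> w ^ 2 * N2 = 1 -> w = sign w / sqrt N2.
Proof.
intros HN Hw.
assert (Hs : 0 < sqrt N2) by now apply sqrt_lt_R0.
assert (E : (w * sqrt N2) * (w * sqrt N2) = 1).
{ transitivity (w ^ 2 * (sqrt N2 * sqrt N2)); [ring|].
  now rewrite sqrt_sqrt by lra. }
apply (Rmult_eq_reg_r (sqrt N2)); [|lra].
replace (sign w / sqrt N2 * sqrt N2) with (sign w) by (field; lra).
destruct (Rtotal_order w 0) as [H|[H|H]].
- rewrite (sign_eq_m1 w H).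
  assert (w * sqrt N2 < 0) by nra; set (t := w * sqrt N2) in *; nra.
- rewrite H in Hw; lra.
- rewrite (sign_eq_1 w H).
  assert (0 < w * sqrt N2) by nra; set (t := w * sqrt N2) in *; nra.
Qed.

Lemma sign_locally_constant (w : R -> R) :
  continuous w 0 -> w 0 <> 0 -> locally 0 (fun u => sign (w u) = sign (w 0)).
Proof.
intros Hc Hw; destruct (Rtotal_order (w 0) 0) as [H|[H|H]]; [|lra|].
- assert (Hl : locally 0 (fun u => w u < 0)) by exact (Hc _ (open_lt 0 (w 0) H)).
  revert Hl; apply filter_imp; intros u Hu.
  now rewrite !sign_eq_m1.
- assert (Hl : locally 0 (fun u => 0 < w u)) by exact (Hc _ (open_gt 0 (w 0) H)).
  revert Hl; apply filter_imp; intros u Hu.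
  now rewrite !sign_eq_1.
Qed.

(** For [u] near [x], the property holds on a whole neighbourhood of [(u, y)], so it can be
    restricted to the vertical line through that point. *)
Lemma locally_2d_slices (P : R -> R -> Prop) (x y : R) :
  locally_2d P x y -> locally x (fun u => locally y (fun v => P u v)).
Proof.
intros H; assert (H' : locally_2d (fun u v => locally_2d P u v) x y).
{ apply (locally_2d_impl_strong P); [apply locally_2d_forall; auto | exact H]. }
apply locally_2d_1d_const_y in H'; revert H'; apply filter_imp.
intros u; apply locally_2d_1d_const_x.
Qed.

(** [normal_at] on each line of constant [u] fixes the normal up to the sign of its third component
    [w u]. As [w] is continuous and nonzero at 0, this sign is constantly [e] nearby. *)
Lemma normal_along_edge (f nu X : R -> R -> V3) (M : R -> R -> R) (p q : R -> R) :
  smooth_map_at nu 0 0 ->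
  locally_2d (fun u v => dot (nu u v) (nu u v) = 1 /\
                         dot (nu u v) (Du f u v) = 0 /\
                         dot (nu u v) (Dv f u v) = 0) 0 0 ->
  locally_2d (fun u v => Du f u v = X u v /\ Dv f u v = (0, v, v * M u v)) 0 0 ->
  locally 0 (fun u => vcontinuous (X u) 0 /\ continuous (M u) 0 /\
                      X u 0 = (1, p u, q u)) ->
  let m u := M u 0 in
  let N u := sqrt (1 + m u ^ 2 + (p u * m u - q u) ^ 2) in
  let e := sign (c3 (nu 0 0)) in
  (e = 1 \/ e = -1) /\
  locally 0 (fun u =>
    nu u 0 = (e / N u * (p u * m u - q u), - (e / N u) * m u, e / N u) /\
    sign (Derive (fun v => lambda f nu u v) 0) = e).
Proof.
intros [S1 [S2 S3]] HN HD HX m N e.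
set (w u := c3 (nu u 0)).
set (N2 u := 1 + m u ^ 2 + (p u * m u - q u) ^ 2).
assert (HN2 : forall u, 0 < N2 u).
{ intros u; unfold N2; pose proof (pow2_ge_0 (m u)).
  pose proof (pow2_ge_0 (p u * m u - q u)); lra. }
assert (HC : locally_2d (fun u v => continuity_2d_pt (fun x y => c1 (nu x y)) u v /\
    continuity_2d_pt (fun x y => c2 (nu x y)) u v /\
    continuity_2d_pt (fun x y => c3 (nu x y)) u v) 0 0).
{ repeat apply locally_2d_and; [revert S1 | revert S2 | revert S3];
    apply locally_2d_impl, locally_2d_forall; intros u v H; apply (H 0%nat). }
assert (HW : continuous w 0).
{ apply (continuous_slice_x (fun x y => c3 (nu x y))), (locally_2d_singleton _ _ _ HC). }
assert (HL : locally 0 (fun u =>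
    nu u 0 = (w u * (p u * m u - q u), - w u * m u, w u) /\
    w u ^ 2 * N2 u = 1 /\
    sign (Derive (fun v => lambda f nu u v) 0) = sign (w u))).
{ assert (HD' := locally_2d_slices _ _ _ (locally_2d_and _ _ _ _ HN HD)).
  apply locally_2d_1d_const_y in HC.
  generalize (filter_and _ _ HX (filter_and _ _ HC HD')).
  apply filter_imp; intros u [[HXc [HMc HX0]] [[C1 [C2 C3]] Hu]].
  destruct (normal_at (nu u) (X u) (M u) (p u) (q u)) as [E1 [E2 E3]]; auto.
  - repeat split; now apply (continuous_slice_y (fun x y => _ (nu x y))).
  - revert Hu; apply filter_imp; intros v [[I1 [I2 I3]] [I4 I5]].
    rewrite I4 in I2; rewrite I5 in I3; auto.
  - split; [exact E1 | split; [exact E2|]].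
    rewrite (Derive_ext_loc _ (fun v => det3 (X u v) (0, v, v * M u v) (nu u v))).
    (* The derivative of [lambda] across the edge is [w u * N2 u] with [N2 u > 0], so its sign is
       that of the normal's third component. *)
    + etransitivity; [apply f_equal, (is_derive_unique _ _ _ E3)|].
      apply sign_mult_pos, HN2.
    + revert Hu; apply filter_imp; intros v [_ [I4 I5]].
      unfold lambda; now rewrite I4, I5. }
assert (Hw0 : w 0 <> 0).
{ destruct (locally_singleton _ _ HL) as [_ [H _]]; intros H0; rewrite H0 in H.
  lra. }
split.
- change e with (sign (w 0)); destruct (Rtotal_order (w 0) 0) as [H|[H|H]].
  + right; now apply sign_eq_m1.
  + contradiction.
  + left; now apply sign_eq_1.
- generalize (filter_and _ _ HL (sign_locally_constant w HW Hw0)).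
  apply filter_imp; intros u [[E1 [E2 E3]] E4].
  assert (E5 : w u = e / N u).
  { change e with (sign (w 0)); rewrite <- E4.
    exact (sign_over_sqrt (w u) (N2 u) (HN2 u) E2). }
  rewrite <- E5; split; [exact E1|]; now rewrite E3.
Qed.

(** * Curvature formulas for the singular curve *)

Lemma enorm_graph_tangent (p q : R) :
  enorm (1, p, q) = sqrt (1 + p ^ 2 + q ^ 2).
Proof. unfold enorm, dot, c1, c2, c3; cbn -[pow]; f_equal; ring. Qed.

(** The sign [e] enters through the normal and through [d lambda (eta)]; since [e * e = 1], the
    choice of normal disappears. *)
Lemma kappa_s_graph (f nu : R -> R -> V3) (u p q p' q' m N e : R) :
  e = 1 \/ e = -1 ->
  vderive (singular_image f) u = (1, p, q) ->
  vderive (vderive (singular_image f)) u = (0, p', q') ->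
  nu u 0 = (e / N * (p * m - q), - (e / N) * m, e / N) ->
  sign (Derive (fun v => lambda f nu u v) 0) = e ->
  kappa_s f nu u = (p' + m * q' + (p * m - q) * (p * q' - q * p')) / N
                   / sqrt (1 + p ^ 2 + q ^ 2) ^ 3.
Proof.
intros He H1 H2 Hn Hs; unfold kappa_s; rewrite Hs, H1, H2, Hn, enorm_graph_tangent.
unfold det3, dot, cross, c1, c2, c3; cbn -[pow]; unfold Rdiv.
destruct He as [-> | ->]; ring.
Qed.

(** Here one factor [e] survives: reversing the normal reverses the limiting normal curvature. *)
Lemma kappa_nu_graph (f nu : R -> R -> V3) (u p q p' q' m N e : R) :
  vderive (singular_image f) u = (1, p, q) ->
  vderive (vderive (singular_image f)) u = (0, p', q') ->
  nu u 0 = (e / N * (p * m - q), - (e / N) * m, e / N) ->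
  kappa_nu f nu u = e * ((q' - m * p') / N / sqrt (1 + p ^ 2 + q ^ 2) ^ 2).
Proof.
intros H1 H2 Hn; unfold kappa_nu; rewrite H1, H2, Hn, enorm_graph_tangent.
unfold dot, c1, c2, c3; cbn -[pow]; unfold Rdiv; ring.
Qed.

Lemma curvature_graph (g : R -> V3) (u p q p' q' : R) :
  vderive g u = (1, p, q) -> vderive (vderive g) u = (0, p', q') ->
  curvature g u = sqrt ((p * q' - q * p') ^ 2 + q' ^ 2 + p' ^ 2)
                  / sqrt (1 + p ^ 2 + q ^ 2) ^ 3.
Proof.
intros H1 H2; unfold curvature; rewrite H1, H2, enorm_graph_tangent.
unfold enorm, dot, cross, c1, c2, c3; cbn -[pow]; do 2 f_equal; ring.
Qed.

Lemma smooth1_at_ex_derive3 (h : R -> R) :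
  smooth1_at h 0 ->
  locally 0 (fun u => ex_derive h u /\ ex_derive (Derive h) u /\
                      ex_derive (Derive (Derive h)) u).
Proof.
unfold smooth1_at; apply filter_imp; intros u H.
exact (conj (H 1%nat) (conj (H 2%nat) (H 3%nat))).
Qed.

(** Each differentiation needs the previous formula on a neighbourhood, hence the local statements;
    the third derivative enters only the torsion at the origin. *)
Lemma vderive_graph (g : R -> V3) (a a' b b' : R) (h k : R -> R) :
  smooth1_at h 0 -> smooth1_at k 0 ->
  locally 0 (fun u => g u = (u, jet a a' h u, jet b b' k u)) ->
  locally 0 (fun u => vderive g u = (1, jet' a a' h u, jet' b b' k u) /\
             vderive (vderive g) u = (0, jet'' a a' h u, jet'' b b' k u)) /\
  vderive (vderive (vderive g)) 0 = (0, a', b').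
Proof.
intros Hh Hk Hg; apply smooth1_at_ex_derive3 in Hh, Hk.
assert (HG1 : locally 0 (fun u => vderive g u = (1, jet' a a' h u, jet' b b' k u))).
{ apply locally_locally in Hg.
  generalize (filter_and _ _ Hg (filter_and _ _ Hh Hk)); apply filter_imp.
  intros u [H [[H1 _] [K1 _]]]; rewrite (vderive_ext_loc _ _ _ H).
  apply vderive_eq; unfold c1, c2, c3; cbn;
    [auto_derive; auto | now apply is_derive_jet | now apply is_derive_jet]. }
assert (HG2 : locally 0 (fun u =>
  vderive (vderive g) u = (0, jet'' a a' h u, jet'' b b' k u))).
{ assert (HG1' := locally_locally _ _ HG1).
  generalize (filter_and _ _ HG1' (filter_and _ _ Hh Hk)); apply filter_imp.
  intros u [H [[H1 [H2 _]] [K1 [K2 _]]]]; rewrite (vderive_ext_loc _ _ _ H).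
  apply vderive_eq; unfold c1, c2, c3; cbn;
    [auto_derive; auto | now apply is_derive_jet' | now apply is_derive_jet']. }
split; [now apply filter_and|].
rewrite (vderive_ext_loc _ _ _ HG2).
destruct (locally_singleton _ _ Hh) as [H1 [H2 H3]].
destruct (locally_singleton _ _ Hk) as [K1 [K2 K3]].
apply vderive_eq; unfold c1, c2, c3; cbn;
  [auto_derive; auto | now apply is_derive_jet''_0 | now apply is_derive_jet''_0].
Qed.

Ltac continuity_in_v :=
  repeat first [ assumption | apply continuous_const | apply continuous_id
    | apply @continuous_plus | apply @continuous_mult
    | match goal with |- continuous (fun x => x ^ ?n) _ =>
        apply (ex_derive_continuous (fun x => x ^ n)); auto_derive; exact I
      end ].

(** * The invariants at the origin *)

Theorem theorem4p4
  (a20 a30 b20 b30 b12 b03 : R)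
  (h1 h2 h3 h4 : R -> R) (h5 : R -> R -> R)
  (f nu : R -> R -> V3)
  (Hb03 : b03 <> 0) (Hb20 : 0 <= b20)
  (Hh1 : smooth1_at h1 0) (Hh2 : smooth1_at h2 0)
  (Hh3 : smooth1_at h3 0) (Hh4 : smooth1_at h4 0)
  (Hh5 : smooth2_at h5 0 0)
  (Hf : locally_2d (fun u v =>
     f u v =
     plus
       ((u,
         a20 / 2 * u ^ 2 + a30 / 6 * u ^ 3 + 1 / 2 * v ^ 2,
         b20 / 2 * u ^ 2 + b30 / 6 * u ^ 3 + b12 / 2 * u * v ^ 2
           + b03 / 6 * v ^ 3) : V3)
       ((0,
         u ^ 4 * h1 u,
         u ^ 4 * h2 u + u ^ 2 * v ^ 2 * h3 u + u * v ^ 3 * h4 u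
           + v ^ 4 * h5 u v) : V3)) 0 0)
  (Hnu : unit_normal_near0 f nu) :
  kappa_s f nu 0 = a20 /\
  is_derive (kappa_s f nu) 0 (a30 + b12 * b20) /\
  kappa_n f nu 0 = b20 /\
  is_umbilic_curvature f b20 /\
  (* [kappa_n] is an absolute value: it may fail to be differentiable at 0
     when [b20 = 0] *)
  (0 < b20 -> is_derive (kappa_n f nu) 0 (b30 - a20 * b12)) /\
  (forall l : R, is_derive (kappa_n f nu) 0 l -> l = b30 - a20 * b12) /\
  (0 < c3 (nu 0 0) -> is_derive (kappa_nu f nu) 0 (b30 - a20 * b12)) /\
  curvature (singular_image f) 0 = sqrt (a20 ^ 2 + b20 ^ 2) /\
  (a20 ^ 2 + b20 ^ 2 <> 0 ->
     is_derive (curvature (singular_image f)) 0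
       ((a20 * a30 + b20 * b30) / sqrt (a20 ^ 2 + b20 ^ 2)) /\
     torsion (singular_image f) 0
       = (a20 * b30 - b20 * a30) / (a20 ^ 2 + b20 ^ 2)).
Proof.
change (locally_2d (fun u v => f u v =
  edge_form a20 a30 b20 b30 b12 b03 h1 h2 h3 h4 h5 u v) 0 0) in Hf.
destruct Hnu as [Snu Hnu].
set (M := edge_slope b12 b03 h3 h4 h5).
set (X u v := (1, jet' a20 a30 h1 u,
               jet' b20 b30 h2 u + v * edge_twist b12 h3 h4 h5 u v) : V3).
assert (HS : locally_2d (fun u v =>
  (ex_derive h1 u /\ ex_derive h2 u /\ ex_derive h3 u /\ ex_derive h4 u) /\
  ex_diff_n h5 1 u v) 0 0).
{ apply locally_2d_and.
  - apply (locally_2d_of_1d (fun u =>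
      ex_derive h1 u /\ ex_derive h2 u /\ ex_derive h3 u /\ ex_derive h4 u)).
    repeat apply filter_and; [revert Hh1|revert Hh2|revert Hh3|revert Hh4];
      unfold smooth1_at; apply filter_imp; intros u H; exact (H 1%nat).
  - revert Hh5; apply locally_2d_impl, locally_2d_forall; auto. }
assert (HD : locally_2d (fun u v =>
  Du f u v = X u v /\ Dv f u v = (0, v, v * M u v)) 0 0).
{ revert HS; apply locally_2d_impl.
  (* The strong form retains the equality with [edge_form] around each nearby point, so partial
     derivatives may be transferred there. *)
  revert Hf; apply locally_2d_impl_strong, locally_2d_forall.
  intros u v H [[E1 [E2 [E3 E4]]] [_ [E5 [E6 _]]]]; split.
  - etransitivity; [apply vderive_ext_loc, (locally_2d_1d_const_y _ _ _ H)|].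
    now apply Du_edge_form.
  - etransitivity; [apply vderive_ext_loc, (locally_2d_1d_const_x _ _ _ H)|].
    now apply Dv_edge_form. }
assert (HT : locally 0 (fun u =>
  continuous (edge_twist b12 h3 h4 h5 u) 0 /\ continuous (M u) 0)).
{ apply locally_2d_1d_const_y in HS; revert HS; apply filter_imp.
  intros u [_ [C5 [_ [_ [[Cu _] [Cv _]]]]]].
  apply continuous_slice_y in C5, Cu, Cv.
  split; unfold M, edge_slope, edge_twist; continuity_in_v. }
assert (HX : locally 0 (fun u => vcontinuous (X u) 0 /\ continuous (M u) 0 /\
  X u 0 = (1, jet' a20 a30 h1 u, jet' b20 b30 h2 u))).
{ revert HT; apply filter_imp; intros u [CT CM].
  split; [|split; [exact CM | unfold X; now rewrite Rmult_0_l, Rplus_0_r]].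
  unfold X; split; [|split]; unfold c1, c2, c3; cbn; continuity_in_v. }
destruct (normal_along_edge f nu X M _ _ Snu Hnu HD HX) as [He Hne].
set (e := sign (c3 (nu 0 0))) in *.
assert (HG : locally 0 (fun u => singular_image f u =
  (u, jet a20 a30 h1 u, jet b20 b30 h2 u))).
{ apply locally_2d_1d_const_y in Hf; revert Hf; apply filter_imp.
  intros u H; unfold singular_image; rewrite H.
  apply V3_ext; unfold jet, c1, c2, c3; cbn -[pow]; ring. }
destruct (vderive_graph _ _ _ _ _ _ _ Hh1 Hh2 HG) as [HG12 HG3].
set (g := singular_image f) in *.
pose proof (filter_and _ _ HG12 Hne) as HK.
(* On [v = 0] the slope is [b12 * u] plus a term of order [u ^ 2]. *)
assert (Hm : is_derive (fun u => M u 0) 0 b12).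
{ apply (is_derive_ext (fun u => b12 * u + 2 * u ^ 2 * h3 u)).
  - intros u; change (b12 * u + 2 * u ^ 2 * h3 u = M u 0).
    unfold M, edge_slope; ring.
  - auto_derive; [exact (smooth1_at_ex_derive h3 0 Hh3) | ring]. }
assert (HM0 : M 0 0 = 0) by (unfold M, edge_slope; ring).
assert (J1 : forall a b h, jet' a b h 0 = 0) by (intros; unfold jet'; ring).
assert (J2 : forall a b h, jet'' a b h 0 = a) by (intros; unfold jet''; ring).
destruct (locally_singleton _ _ (smooth1_at_ex_derive3 _ Hh1)) as [A1 [A2 A3]].
destruct (locally_singleton _ _ (smooth1_at_ex_derive3 _ Hh2)) as [B1 [B2 B3]].
assert (P1 : is_derive (jet' a20 a30 h1) 0 a20).
{ rewrite <- (J2 a20 a30 h1) at 2; now apply is_derive_jet'. }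
assert (Q1 : is_derive (jet' b20 b30 h2) 0 b20).
{ rewrite <- (J2 b20 b30 h2) at 2; now apply is_derive_jet'. }
assert (P2 := is_derive_jet''_0 a20 a30 h1 A1 A2 A3).
assert (Q2 := is_derive_jet''_0 b20 b30 h2 B1 B2 B3).
destruct (locally_singleton _ _ HG12) as [G1 G2].
rewrite !J1 in G1; rewrite !J2 in G2.
assert (Ks := is_derive_singular_curvature _ _ _ _ (fun u => M u 0) _ _ _ _ _
  (J1 _ _ _) (J1 _ _ _) HM0 (J2 _ _ _) (J2 _ _ _) P1 Q1 Hm P2 Q2).
assert (Kn := is_derive_normal_curvature _ _ _ _ (fun u => M u 0) _ _ _ _ _
  (J1 _ _ _) (J1 _ _ _) HM0 (J2 _ _ _) (J2 _ _ _) P1 Q1 Hm P2 Q2).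
cbv beta in Ks, Kn.
(* [K] is the limiting normal curvature for the normal with positive third component; [kappa_n] is
   its absolute value for either normal. *)
match type of Kn with is_derive ?k _ _ => set (K := k) in Kn end.
assert (HK0 : K 0 = b20).
{ unfold K; rewrite HM0, !J1, !J2; sqrt_one; field. }
assert (Hks : is_derive (kappa_s f nu) 0 (a30 + b12 * b20)).
{ refine (is_derive_ext_loc _ _ _ _ _ Ks).
  revert HK; apply filter_imp; intros u [[E1 E2] [E3 E4]]; symmetry.
  exact (kappa_s_graph f nu u _ _ _ _ _ _ e He E1 E2 E3 E4). }
assert (Hkn : locally 0 (fun u => kappa_nu f nu u = e * K u)).
{ revert HK; apply filter_imp; intros u [[E1 E2] [E3 _]].
  exact (kappa_nu_graph f nu u _ _ _ _ _ _ e E1 E2 E3). }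
assert (Hka : locally 0 (fun u => kappa_n f nu u = Rabs (K u))).
{ revert Hkn; apply filter_imp; intros u Hu; unfold kappa_n.
  rewrite Hu, Rabs_mult; destruct He as [-> | ->];
    [rewrite Rabs_R1 | rewrite (Rabs_left (-1)) by lra]; ring. }
assert (Hka' : forall l, is_derive (kappa_n f nu) 0 l <->
                         is_derive (fun u => Rabs (K u)) 0 l).
{ intros l; split; apply is_derive_ext_loc; [exact Hka|].
  revert Hka; apply filter_imp; now symmetry. }
refine (conj _ (conj Hks (conj _ (conj _ (conj _ (conj _ (conj _ (conj _
  (fun H => conj _ _))))))))).
- destruct (locally_singleton _ _ HK) as [[E1 E2] [E3 E4]].
  rewrite (kappa_s_graph f nu 0 _ _ _ _ _ _ e He E1 E2 E3 E4).
  rewrite HM0, !J1, !J2; sqrt_one; field.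
- rewrite (locally_singleton _ _ Hka), HK0; now apply Rabs_pos_eq.
- apply (is_umbilic_curvature_half_line f a20 b20 Hb20).
  assert (HD' := locally_2d_singleton _ _ _ HD); destruct HD' as [U0 V0].
  assert (HDx := locally_2d_1d_const_x _ _ _ HD).
  destruct (locally_singleton _ _ HT) as [CT CM].
  apply Delta_half_line.
  + exact G1.
  + rewrite V0, Rmult_0_l; reflexivity.
  + exact G2.
  + unfold Dv; rewrite (vderive_ext_loc _ (X 0)).
    * apply vderive_eq; unfold X, c1, c2, c3; cbn.
      -- auto_derive; auto.
      -- auto_derive; auto.
      (* Along [u = 0] the third component of [f_u] is a constant plus [v] times the twist, which is
         0 at the origin. *)
      -- replace 0 with (0 + edge_twist b12 h3 h4 h5 0 0) at 2
           by (unfold edge_twist; ring).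
         apply @is_derive_plus; [apply @is_derive_const|].
         now apply is_derive_id_mult.
    * revert HDx; apply filter_imp; now intros v [H _].
  + unfold Dv at 1; rewrite (vderive_ext_loc _ (fun v => (0, v, v * M 0 v))).
    * apply vderive_eq; unfold c1, c2, c3; cbn.
      -- auto_derive; auto.
      -- auto_derive; auto.
      -- assert (E := is_derive_id_mult (M 0) CM); rewrite HM0 in E; exact E.
    * revert HDx; apply filter_imp; now intros v [_ H].
- intros Hb; apply Hka', is_derive_Rabs_pos; [now rewrite HK0 | exact Kn].
(* For [b20 > 0] the value follows from uniqueness of the derivative; for [b20 = 0], [K] vanishes at
   0, so differentiability of its absolute value forces the derivative of [K] to be 0. *)
- intros l Hl; destruct Hb20 as [Hb|Hb].
  + rewrite <- (is_derive_unique _ _ _ Hl); apply is_derive_unique.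
    apply Hka', is_derive_Rabs_pos; [now rewrite HK0 | exact Kn].
  + apply Hka' in Hl; apply (is_derive_Rabs_zero K); auto.
    now rewrite HK0.
- intros Hpos; assert (E1 : e = 1) by now apply sign_eq_1.
  apply (is_derive_ext_loc K); [|exact Kn].
  revert Hkn; apply filter_imp; intros u ->.
  rewrite E1; symmetry; apply Rmult_1_l.
- rewrite (curvature_graph g 0 _ _ _ _ G1 G2).
  replace (1 + 0 ^ 2 + 0 ^ 2) with 1 by ring; rewrite sqrt_1.
  replace (_ + b20 ^ 2 + a20 ^ 2) with (a20 ^ 2 + b20 ^ 2) by ring; field.
- refine (is_derive_ext_loc _ _ _ _ _ (is_derive_graph_curvature _ _ _ _ _ _ _ _
    H (J1 _ _ _) (J1 _ _ _) (J2 _ _ _) (J2 _ _ _) P1 Q1 P2 Q2)).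
  revert HG12; apply filter_imp; intros u [E1 E2]; symmetry.
  exact (curvature_graph g u _ _ _ _ E1 E2).
- unfold torsion; rewrite G1, G2, HG3; unfold enorm.
  rewrite pow2_sqrt.
  + unfold det3, dot, cross, c1, c2, c3; cbn -[pow]; field.
    intros H0; apply H; rewrite <- H0; ring.
  + unfold dot; nra.
Qed.
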